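(* Let $M>0$, $R>2M$, $B_\infty\in\mathbb{R}$, and $f(r)=1-\frac{2M}{r}$. For $\mu\in\mathbb{R}$ define, for $r>2M$, $\Psi=\Psi_0+\Psi_{\mathrm{GO}}$ with $$\Psi_0(r,\theta)=-B_\infty f(r)\,r\cos\theta,\qquad \Psi_{\mathrm{GO}}(r,\theta)=\frac{3\mu}{(2M)^2}\left(1+f(r)+\frac rM f(r)\ln f(r)\right)\cos\theta .$$ Then the Neumann boundary condition $\frac{\partial\Psi}{\partial r}(R,\theta)=0$ for all $\theta$ holds if and only if $$\mu=\frac{(2M)^2B_\infty}{3}\left(\frac{3-f(R)}{R}+\frac1M\ln f(R)\right)^{-1}.$$ Moreover, for fixed $R>0$ and $B_\infty$, this induced dipole moment, as a function of $M$, satisfies as $M\to0^+$ $$\mu(M)=-\frac{B_\infty R^3}{2}+\frac{3B_\infty R^2}{4}\,M+O(M^2).$$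
   Context: $\Psi$ is the magnetic scalar potential, on the Schwarzschild exterior of mass $M$, of a superposition of an asymptotically homogeneous field of strength $B_\infty$ ($\Psi_0$) and a magnetic dipole field of dipole moment $\mu$ ($\Psi_{\mathrm{GO}}$). The Neumann condition at $r=R$ expresses that the normal component of the magnetic field vanishes on the surface of an idealized spherically symmetric, perfectly conducting star of radius $R$ that expels the magnetic field. *)

(* Defs.v *)
From HB Require Import structures.
From mathcomp Require Import all_boot all_order all_algebra.
From mathcomp Require Import all_classical all_reals all_analysis.

Set Implicit Arguments.
Unset Strict Implicit.
Unset Printing Implicit Defensive.

Import Order.TTheory GRing.Theory Num.Theory.
Import numFieldNormedType.Exports.

Local Open Scope classical_set_scope.
Local Open Scope ring_scope.

Section SchwarzschildPotential.
Context {R : realType}.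
Implicit Types (M Binf mu r theta : R).

Definition schwarzschild_f M r : R := 1 - 2 * M / r.

(* The potentials are total functions of r; they have their physical meaning
   on the exterior region 2 * M < r, where 0 < schwarzschild_f M r. *)
Definition Psi0 M Binf r theta : R :=
  - Binf * schwarzschild_f M r * r * cos theta.

Definition PsiGO M mu r theta : R :=
  3 * mu / (2 * M) ^+ 2 *
  (1 + schwarzschild_f M r +
   r / M * schwarzschild_f M r * ln (schwarzschild_f M r)) * cos theta.

Definition Psi M Binf mu r theta : R :=
  Psi0 M Binf r theta + PsiGO M mu r theta.

(* is_derive asserts differentiability in r besides the value of the derivative.
   theta ranges over all reals; as theta enters only through cos theta, this is
   the same as letting it range over [0, pi]. *)
Definition neumann_condition M Binf mu (rs : R) : Prop :=
  forall theta, is_derive rs 1 (fun r => Psi M Binf mu r theta) 0.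

(* For 0 < M and 2 * M < rs, the expression inverted below is nonzero, so the
   convention 0^-1 = 0 plays no role. *)
Definition induced_dipole_moment Binf (rs : R) M : R :=
  (2 * M) ^+ 2 * Binf / 3 *
  ((3 - schwarzschild_f M rs) / rs + 1 / M * ln (schwarzschild_f M rs))^-1.

End SchwarzschildPotential.

(* Main.v *)
Require Import Defs.
From HB Require Import structures.
From mathcomp Require Import all_boot all_order all_algebra.
From mathcomp Require Import all_classical all_reals all_analysis.
From mathcomp Require Import ring lra.

Set Implicit Arguments.
Unset Strict Implicit.
Unset Printing Implicit Defensive.

Import Order.TTheory GRing.Theory Num.Theory.
Import numFieldNormedType.Exports.

Local Open Scope classical_set_scope.
Local Open Scope ring_scope.

(** Since [d/dr (1 + f + (r/M) f ln f) = (3 - f)/r + (ln f)/M], the Neumann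
    condition is linear in [mu].  With [x = 2M/R], its coefficient is
    [- t(x) / M] up to a nonzero factor, where
    [t(x) = - ln (1 - x) - x - x^2/2] is positive on ]0, 1[, so that
    [mu = - (B R^3 / 2) * (x^3 / (3 t(x)))]. Comparing derivatives gives
    [x^3/3 + x^4/4 <= t(x) <= x^3/3 + x^4/4 + 2 x^5/5] for [0 <= x <= 1/2],
    hence [x^3 / (3 t(x)) = 1 - 3x/4 + O(x^2)]. *)

(** Derivability on the closed interval also supplies the continuity at the endpoints that
    monotonicity requires. *)
Lemma is_derive_ge0_le (R : realType) (g dg : R -> R) (a b : R) :
  a <= b -> (forall y, a <= y <= b -> is_derive y 1 g (dg y)) ->
  (forall y, a <= y <= b -> 0 <= dg y) -> g a <= g b.
Proof.
move=> ab gdg dg0.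
have Dg y : y \in `]a, b[ -> is_derive y 1 g (dg y).
  by rewrite in_itv /= => /andP[ay yb]; apply: gdg; rewrite !ltW.
apply: (@ger0_derive1_ndecr R g a b) => //.
- by move=> y /Dg [].
- move=> y yab; rewrite derive1E (@derive_val _ _ _ _ _ _ _ (Dg _ yab)).
  by move: yab; rewrite in_itv /= => /andP[ay yb]; apply: dg0; rewrite !ltW.
- apply: derivable_within_continuous => y.
  by rewrite in_itv /= => /gdg [].
Qed.

(** For [0 <= x < 1], the part of degree at least 3 of the Mercator series of [- ln (1 - x)]. *)
Definition ln1B_tail (R : realType) (x : R) : R := - ln (1 - x) - x - x ^+ 2 / 2.

Lemma is_derive_ln1B_tail (R : realType) (x : R) :
  x < 1 -> is_derive x 1 (@ln1B_tail R) (x ^+ 2 / (1 - x)).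
Proof.
move=> x1; have x0 : 0 < 1 - x by rewrite subr_gt0.
have D1 : is_derive x 1 (fun y : R => 1 - y) (-1).
  by apply: is_derive_eq; rewrite add0r mul1r.
have D2 : is_derive x 1 (fun y : R => ln (1 - y)) ((1 - x)^-1 * -1).
  exact: (@is_derive1_comp _ (@ln R) (fun y => 1 - y) _ _ _ (is_derive1_ln x0) D1).
rewrite /ln1B_tail; apply: is_derive_eq.
rewrite /GRing.scale /=; field; lra.
Qed.

(** Both sides vanish at 0, and their difference has derivative [y ^+ 4 / (1 - y)]. *)
Lemma ln1B_tail_ge (R : realType) (x : R) :
  0 <= x < 1 -> x ^+ 3 / 3 + x ^+ 4 / 4 <= ln1B_tail x.
Proof.
move=> /andP[x0 x1]; rewrite -subr_ge0.
pose g (y : R) : R := ln1B_tail y - (y ^+ 3 / 3 + y ^+ 4 / 4).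
have g0 : g 0 = 0 by rewrite /g /ln1B_tail (subr0 1) ln1; ring.
rewrite -[leRHS]/(g x) -[leLHS]g0.
apply: (@is_derive_ge0_le _ g (fun y => y ^+ 2 / (1 - y) - (y ^+ 2 + y ^+ 3)) 0 x) => [//| |].
- move=> y /andP[y0 yx]; have D := is_derive_ln1B_tail (le_lt_trans yx x1).
  by apply: is_derive_eq; rewrite /GRing.scale /=; field; lra.
- move=> y /andP[y0 yx].
  have -> : y ^+ 2 / (1 - y) - (y ^+ 2 + y ^+ 3) = y ^+ 4 / (1 - y) by field; lra.
  by rewrite divr_ge0 ?exprn_ge0//; lra.
Qed.

(** For [y <= 1/2] the remainder [y ^+ 4 / (1 - y)] of the derivative is at most [2 * y ^+ 4], whose
    primitive is the term with [2 / 5]. *)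
Lemma ln1B_tail_le (R : realType) (x : R) :
  0 <= x <= 2^-1 -> ln1B_tail x <= x ^+ 3 / 3 + x ^+ 4 / 4 + 2 / 5 * x ^+ 5.
Proof.
move=> /andP[x0 x1]; rewrite -subr_ge0.
pose g (y : R) : R := y ^+ 3 / 3 + y ^+ 4 / 4 + 2 / 5 * y ^+ 5 - ln1B_tail y.
have g0 : g 0 = 0 by rewrite /g /ln1B_tail (subr0 1) ln1; ring.
rewrite -[leRHS]/(g x) -[leLHS]g0.
apply: (@is_derive_ge0_le _ g
  (fun y => y ^+ 2 + y ^+ 3 + 2 * y ^+ 4 - y ^+ 2 / (1 - y)) 0 x) => [//| |].
- move=> y /andP[y0 yx]; have y1 : y < 1 by lra.
  have D := is_derive_ln1B_tail y1.
  by apply: is_derive_eq; rewrite /GRing.scale /=; field; lra.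
- move=> y /andP[y0 yx].
  have -> : y ^+ 2 + y ^+ 3 + 2 * y ^+ 4 - y ^+ 2 / (1 - y)
            = y ^+ 4 * (1 - 2 * y) / (1 - y) by field; lra.
  by rewrite divr_ge0 ?mulr_ge0 ?exprn_ge0//; lra.
Qed.

Lemma ln1B_tail_gt0 (R : realType) (x : R) : 0 < x < 1 -> 0 < ln1B_tail x.
Proof.
move=> /andP[x0 x1]; apply: lt_le_trans (ln1B_tail_ge _); last by rewrite ltW.
by rewrite addr_gt0// divr_gt0// exprn_gt0.
Qed.

Lemma cube_div_ln1B_tail (R : realType) (x : R) : 0 < x <= 2^-1 ->
  `|x ^+ 3 / (3 * ln1B_tail x) - (1 - 3 / 4 * x)| <= 2 * x ^+ 2.
Proof.
move=> /andP[x0 x1].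
have x01 : 0 <= x < 1 by apply/andP; split; lra.
have := ln1B_tail_ge x01.
have /ln1B_tail_le : 0 <= x <= 2^-1 by rewrite ltW.
have x3 : 0 < x ^+ 3 by exact: exprn_gt0.
have x2 : 0 < x ^+ 2 by exact: exprn_gt0.
pose k := 3 * ln1B_tail x / x ^+ 3.
have -> : ln1B_tail x = x ^+ 3 * k / 3 by rewrite /k; field; lra.
have -> : x ^+ 3 / 3 + x ^+ 4 / 4 + 2 / 5 * x ^+ 5
  = x ^+ 3 * (1 + 3 / 4 * x + 6 / 5 * x ^+ 2) / 3 by field.
have -> : x ^+ 3 / 3 + x ^+ 4 / 4 = x ^+ 3 * (1 + 3 / 4 * x) / 3 by field.
rewrite !ler_pM2r ?invr_gt0// !ler_pM2l// => kle kge.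
have k1 : 1 <= k by lra.
have -> : x ^+ 3 / (3 * (x ^+ 3 * k / 3)) - (1 - 3 / 4 * x)
  = (1 - k * (1 - 3 / 4 * x)) / k by field; apply/andP; split; lra.
rewrite normrM normfV (ger0_norm (le_trans ler01 k1)).
(* As [1 - 3/4 x > 0], the bounds on [k] place [1 - k (1 - 3/4 x)] between [- 6/5 x^2] and
   [9/16 x^2]; with [1 <= k] this is within [2 x^2 k]. *)
rewrite ler_pdivrMr; last lra.
rewrite ler_norml; apply/andP; split; nra.
Qed.

Definition neumann_factor (R : realType) (M r : R) : R :=
  (3 - schwarzschild_f M r) / r + 1 / M * ln (schwarzschild_f M r).

(** With [x = 2M/r] one has [f = 1 - x] and [1/r = x/(2M)], so [(3 - f)/r = (x + x^2/2)/M] removes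
    the first two terms of the logarithm. *)
Lemma neumann_factorE (R : realType) (M r : R) : 0 < M -> 0 < r ->
  neumann_factor M r = - ln1B_tail (2 * M / r) / M.
Proof.
move=> M0 r0; rewrite /neumann_factor /schwarzschild_f /ln1B_tail.
by field; apply/andP; split; lra.
Qed.

Lemma exterior_ratio (R : realType) (M r : R) :
  0 < M -> 2 * M < r -> 0 < 2 * M / r < 1.
Proof.
move=> M0 Mr; have r0 : 0 < r by lra.
by rewrite divr_gt0 ?mulr_gt0//= ltr_pdivrMr// mul1r.
Qed.

(** This makes the linear equation for [mu] uniquely solvable. *)
Lemma neumann_factor_neq0 (R : realType) (M r : R) :
  0 < M -> 2 * M < r -> neumann_factor M r != 0.
Proof.
move=> M0 Mr; rewrite neumann_factorE//; last lra.
rewrite mulf_neq0 ?invr_neq0 ?oppr_eq0// gt_eqF//.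
exact/ln1B_tail_gt0/exterior_ratio.
Qed.

(** Since [f(r) r = r - 2M] has slope 1, the homogeneous field contributes [- B]; the dipole
    contributes the multiple of [neumann_factor]. *)
Lemma is_derive_Psi (R : realType) (M B mu r theta : R) :
  0 < M -> 2 * M < r ->
  is_derive r 1 (fun s => Psi M B mu s theta)
    ((3 * mu / (2 * M) ^+ 2 * neumann_factor M r - B) * cos theta).
Proof.
move=> M0 Mr; have r0 : r != 0 by lra.
have f0 : 0 < schwarzschild_f M r.
  by have := exterior_ratio M0 Mr; rewrite subr_gt0 => /andP[].
have D1 : is_derive r 1 (fun s : R => s^-1) (- r ^- 2).
  by apply: is_derive_eq; [exact: (@is_deriveV _ id)|rewrite /GRing.scale /= mulr1].
have D2 : is_derive r 1 (schwarzschild_f M) (2 * M * r ^- 2).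
  by rewrite /schwarzschild_f; apply: is_derive_eq; rewrite /GRing.scale /=; ring.
have D3 : is_derive r 1 (fun s => ln (schwarzschild_f M s))
    ((schwarzschild_f M r)^-1 * (2 * M * r ^- 2)).
  exact: (@is_derive1_comp _ (@ln R) (schwarzschild_f M) _ _ _ (is_derive1_ln f0) D2).
rewrite /Psi /Psi0 /PsiGO; apply: is_derive_eq.
rewrite /neumann_factor /GRing.scale /=.
(* Naming the logarithm before unfolding [f] leaves a rational identity. *)
set l := ln _; rewrite /schwarzschild_f in f0 *.
by field; apply/and3P; split; lra.
Qed.

Lemma neumann_conditionP (R : realType) (M B mu r : R) : 0 < M -> 2 * M < r ->
  neumann_condition M B mu r <-> mu = induced_dipole_moment B r M.
Proof.
move=> M0 Mr; have D0 := neumann_factor_neq0 M0 Mr.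
have -> : induced_dipole_moment B r M = (2 * M) ^+ 2 * B / 3 / neumann_factor M r.
  by [].
(* The single angle [theta = 0], where the cosine is 1, already determines [mu], by uniqueness of
   the derivative. *)
split=> [/(_ 0) H|mu_eq theta].
- have := @derive_val _ _ _ _ _ _ _ (is_derive_Psi B mu 0 M0 Mr).
  rewrite (@derive_val _ _ _ _ _ _ _ H) cos0 mulr1 => /esym/subr0_eq <-.
  by field; rewrite D0 gt_eqF.
- apply: is_derive_eq (is_derive_Psi B mu theta M0 Mr) _.
  by rewrite mu_eq; field; rewrite D0 gt_eqF.
Qed.

(** The hypothesis [4 * M <= r] says [x = 2M/r <= 1/2]. The error is [- B r^3/2] times that of
    [cube_div_ln1B_tail], and [2 x^2 = 8 M^2/r^2] gives the constant. *)
Lemma induced_dipole_moment_expansion (R : realType) (B r M : R) :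
  0 < M -> 4 * M <= r ->
  `|induced_dipole_moment B r M
    - (- (B * r ^+ 3 / 2) + 3 * B * r ^+ 2 / 4 * M)| <= 4 * `|B| * r * M ^+ 2.
Proof.
move=> M0 Mr; have r0 : 0 < r by lra.
have x01 : 0 < 2 * M / r < 1 by apply: exterior_ratio => //; lra.
have t0 := ln1B_tail_gt0 x01.
have xle : 0 < 2 * M / r <= 2^-1.
  by case/andP: x01 => -> _ /=; rewrite ler_pdivrMr//; lra.
rewrite /induced_dipole_moment -/(neumann_factor M r) neumann_factorE//.
set x := 2 * M / r in x01 t0 xle *.
have Mx : M = x * r / 2 by rewrite /x; field; lra.
have -> : (2 * M) ^+ 2 * B / 3 / (- ln1B_tail x / M)
    - (- (B * r ^+ 3 / 2) + 3 * B * r ^+ 2 / 4 * M)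
  = - (B * r ^+ 3 / 2) * (x ^+ 3 / (3 * ln1B_tail x) - (1 - 3 / 4 * x)).
  by rewrite Mx; field; rewrite !gt_eqF//; case/andP: x01.
have -> : 4 * `|B| * r * M ^+ 2 = `|B| * r ^+ 3 / 2 * (2 * x ^+ 2).
  by rewrite Mx; field.
rewrite normrM normrN (normrM (B * _)) (normrM B) (gtr0_norm (exprn_gt0 3 r0)) normfV.
rewrite (@ger0_norm _ 2)// ler_wpM2l ?cube_div_ln1B_tail//.
by rewrite divr_ge0// mulr_ge0// exprn_ge0// ltW.
Qed.

Theorem mainTheorem4 (R : realType) (Binf rs : R) :
  (forall M mu : R, 0 < M -> 2 * M < rs ->
    (neumann_condition M Binf mu rs <->
     mu = induced_dipole_moment Binf rs M)) /\
  (0 < rs ->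
    (fun M : R => induced_dipole_moment Binf rs M) =
    (fun M : R => - (Binf * rs ^+ 3 / 2) + 3 * Binf * rs ^+ 2 / 4 * M)
      +O_ (0^'+) (fun M : R => M ^+ 2)).
Proof.
split=> [M mu|rs0]; first exact: neumann_conditionP.
apply/eqaddOP; near=> k.
(* Any [k] above the constant of the explicit bound works, on the right neighbourhood
   [0 < M < rs / 4]. *)
have kB : 4 * `|Binf| * rs <= k.
  by near: k; apply: nbhs_pinfty_ge; rewrite num_real.
near=> M.
have M0 : 0 < M by near: M; exact: nbhs_right_gt.
have Mrs : M < rs / 4 by near: M; apply: nbhs_right_lt; rewrite divr_gt0.
apply: le_trans (induced_dipole_moment_expansion Binf M0 _) _; first lra.
by rewrite (ger0_norm (sqr_ge0 M)) ler_wpM2r ?sqr_ge0.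
Unshelve. all: by end_near.
Qed.
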